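(* Let $f:\mathcal{X}\to\mathbb{R}$ be convex and twice continuously differentiable, $A:\mathcal{X}\to\mathcal{Y}$ a bounded linear operator, $b\in\mathcal{Y}$, $\rho>0$, and let $$\mathcal{L}_\rho(x,y)=f(x)+\langle y,Ax-b\rangle+\frac{\rho}{2}\|Ax-b\|^2.$$ Let $(x^*,y^* )\in\mathcal{X}\times\mathcal{Y}$ satisfy $\nabla f(x^* )+A^*y^*=0$ and $Ax^*=b$. Let $t_0>0$, $\beta,\gamma>0$, $\alpha\ge3$, $r\ge\beta$ and $\frac{1}{\alpha-1}\le\theta\le\frac12$. Let $(x,y):[t_0,\infty)\to\mathcal{X}\times\mathcal{Y}$ be a solution of the system $$\begin{cases}\ddot{x}+\frac{\alpha}{t}\dot{x}+\beta\nabla^2_{xx}\mathcal{L}_\rho(x,y)\dot{x}+\left(\gamma+\frac{r}{t}\right)\nabla_x\mathcal{L}_\rho(x,y+\theta t\dot{y})=0,\\ \ddot{y}+\frac{\alpha}{t}\dot{y}-\left(\gamma+\frac{r}{t}\right)\nabla_y\mathcal{L}_\rho(x+\theta t\dot{x},y)=0,\end{cases}$$ with $(x(t_0),y(t_0))=(x_0,y_0)$ and $(\dot{x}(t_0),\dot{y}(t_0))=(\dot{x}_0,\dot{y}_0)$. Set $\xi=\frac1\theta$, $\eta=\xi(\alpha-1-\xi)$ and $$C_0=2W(t_0)+\xi^2+\eta+t_0(\gamma t_0+r)\|Ax_0-b\|,$$ where $W$ is the energy function defined in the context. Then for every $t\ge t_0$, $$0\le\mathcal{L}_\rho(x(t),y^*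 )-\mathcal{L}_\rho(x^*,y^* )+\|Ax(t)-b\|\le\frac{2C_0}{t(\gamma t+r)}$$ and $$-\frac{2C_0\|y^*\|}{t(\gamma t+r)}\le f(x(t))-f(x^* )\le\frac{2C_0(1+\|y^*\|)}{t(\gamma t+r)}.$$
   Context: $\mathcal{X}$ and $\mathcal{Y}$ are real Hilbert spaces; $A^*:\mathcal{Y}\to\mathcal{X}$ is the adjoint of $A$. The set of pairs $(x^*,y^* )$ with $\nabla f(x^* )+A^*y^*=0$, $Ax^*=b$ is assumed nonempty (such pairs are the saddle points of $\mathcal{L}_\rho$). A solution of the system is a twice differentiable function satisfying it on $[t_0,\infty)$, with $x,y$ evaluated at $t$. Explicitly, $\nabla_x\mathcal{L}_\rho(x,y)=\nabla f(x)+A^*y+\rho A^*(Ax-b)$, $\nabla_y\mathcal{L}_\rho(x,y)=Ax-b$, $\nabla^2_{xx}\mathcal{L}_\rho(x,y)=\nabla^2 f(x)+\rho A^*A$. With $s(t)=(x(t),y(t))$, $s^*=(x^*,y^* )$, the product Hilbert norm on $\mathcal{X}\times\mathcal{Y}$, and $F(x)=\mathcal{L}_\rho(x,y^* )-\mathcal{L}_\rho(x^*,y^* )=f(x)-f(x^* )+\langle y^*,Ax-b\rangle+\frac{\rho}{2}\|Ax-b\|^2$, the energy function is $$W(t)=\tfrac12\|t\dot{s}(t)+\xi(s(t)-s^* )\|^2+\tfrac{\eta}{2}\|s(t)-s^*\|^2+t(\gamma t+r)F(x(t))+\beta\xi t\left[\langle\nabla f(x(t)),x(t)-x^*\rangle-(f(x(t))-f(x^*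 ))\right]+\tfrac{\beta\xi\rho t}{2}\|Ax(t)-b\|^2.$$ *)

(* Defs.v *)
From HB Require Import structures.
From mathcomp Require Import all_boot all_order all_algebra.
From mathcomp Require Import sesquilinear lra ring.
From mathcomp Require Import all_classical all_reals all_analysis.

Set Implicit Arguments.
Unset Strict Implicit.
Unset Printing Implicit Defensive.

Import Order.TTheory GRing.Theory Num.Theory.
Import numFieldNormedType.Exports.

Local Open Scope classical_set_scope.
Local Open Scope ring_scope.

HB.mixin Record isHilbert (R : realType) V & CompleteNormedModule R V := {
  hdot : {dot V for idfun} ;
  hdot_norm : forall u : V, hdot u u = `|u| ^+ 2
}.

#[short(type="hilbertType")]
HB.structure Definition Hilbert (R : realType) :=
  {V of CompleteNormedModule R V & isHilbert R V}.

Notation "'[ u , v ]" := (hdot u v) : ring_scope.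

Section hilbert_theory.
Context {R : realType} {X : hilbertType R}.
Implicit Types u v w : X.

Lemma hdotC u v : '[u, v] = '[v, u].
Proof. by rewrite hermitian_subproof expr0 mul1r. Qed.

Lemma hdot_normD u v : `|u + v| ^+ 2 = `|u| ^+ 2 + 2 * '[u, v] + `|v| ^+ 2.
Proof. by rewrite -!hdot_norm linearDl !linearDr /= (hdotC v u); ring. Qed.

Lemma hdot_normB u v : `|u - v| ^+ 2 = `|u| ^+ 2 - 2 * '[u, v] + `|v| ^+ 2.
Proof. by rewrite hdot_normD normrN linearNr /=; ring. Qed.

Lemma hdot_sep u v : (forall h, '[u, h] = '[v, h]) -> u = v.
Proof.
move=> uv; apply/eqP; rewrite -subr_eq0 -normr_eq0 -sqrf_eq0 -hdot_norm.
by rewrite linearBl /= uv subrr.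
Qed.

Lemma cauchy_schwarz u v : `|'[u, v]| <= `|u| * `|v|.
Proof.
have [->|v0] := eqVneq v 0; first by rewrite linear0r !normr0 mulr0.
have nv : 0 < `|v| by rewrite normr_gt0.
have key c : 0 <= `|u| ^+ 2 + 2 * c * '[u, v] + c ^+ 2 * `|v| ^+ 2.
  have := sqr_ge0 `|u + c *: v|; rewrite hdot_normD linearZr_LR /= normrZ.
  by rewrite exprMn real_normK ?num_real// mulrA.
have := key (- '[u, v] / `|v| ^+ 2).
have -> : `|u| ^+ 2 + 2 * (- '[u, v] / `|v| ^+ 2) * '[u, v] +
    (- '[u, v] / `|v| ^+ 2) ^+ 2 * `|v| ^+ 2 =
    `|u| ^+ 2 - '[u, v] ^+ 2 / `|v| ^+ 2.
  by field; rewrite gt_eqF.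
rewrite subr_ge0 ler_pdivrMr ?exprn_gt0// -exprMn.
by rewrite -[X in X <= _]real_normK ?num_real// ler_pXn2r// nnegrE mulr_ge0.
Qed.

Theorem riesz_representation (phi : {linear X -> R}) :
  continuous phi -> exists g, forall h, phi h = '[g, h].
Proof.
move=> cphi.
have [M M0 phiM] : exists2 M, 0 < M & forall u, `|phi u| <= M * `|u|.
  have /linear_boundedP/pinfty_ex_gt0[M M0 MP] :=
    continuous_linear_bounded 0 (cphi 0).
  by exists M.
have phiZ a u : phi (a *: u) = a * phi u by rewrite linearZ.
pose J u := `|u| ^+ 2 / 2 - phi u.
have Jlb u : - M ^+ 2 / 2 <= J u.
  have := phiM u; rewrite ler_norml => /andP[_]; rewrite /J.
  have := sqr_ge0 (`|u| - M); nra.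
have Jinf : has_inf (range J).
  by split; [exists (J 0), 0 | exists (- M ^+ 2 / 2) => _ [u _ <-]].
pose m := inf (range J).
have mJ u : m <= J u by apply: inf_lbound; [exact: Jinf.2|exists u].
have Jpar u v : `|u - v| ^+ 2 = 4 * (J u + J v - 2 * J (2^-1 *: (u + v))).
  rewrite /J normrZ exprMn gtr0_norm ?invr_gt0// phiZ linearD.
  by rewrite hdot_normB hdot_normD; field.
pose B e := [set u | J u < m + e].
pose F := filter_from [set e : R | 0 < e] B.
have PF : ProperFilter F.
  apply: filter_from_proper; first apply: filter_from_filter.
  - by exists 1 => /=.
  - move=> a b /= a0 b0; exists (Num.min a b); first by rewrite /= lt_min a0.
    by move=> u; rewrite /B /= -ltrBlDl lt_min !ltrBlDl => /andP[].
  - move=> e /= e0.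
    by have [_ [u _ <-] ?] := inf_adherent e0 Jinf; exists u.
have FB e : 0 < e -> F (B e) by move=> e0; exists e.
have Bclose e u v : 0 < e -> B (e ^+ 2 / 8) u -> B (e ^+ 2 / 8) v ->
    `|u - v| < e.
  rewrite /B /= => e0 uB vB; rewrite -(@ltr_pXn2r _ 2) ?nnegrE ?(ltW e0)//.
  rewrite Jpar; have := mJ (2^-1 *: (u + v)); lra.
have e28 e : 0 < e -> 0 < e ^+ 2 / 8 :> R by move=> e0; rewrite divr_gt0 ?exprn_gt0.
have /cauchy_cvg/cvg_ex[g Fg] : cauchy F.
  apply/cauchyP => e e0.
  have [u uB] := @filter_ex _ _ PF _ (FB _ (e28 _ e0)).
  exists u; apply: filterS (FB _ (e28 _ e0)) => v vB.
  by rewrite -ball_normE /=; exact: Bclose.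
have Jg : J g <= m.
  have cJ : {for g, continuous J}.
    apply: cvgB; last exact: cphi.
    apply: cvgMr_tmp.
    apply: (@cvg_comp _ _ _ Num.norm (fun a : R => a ^+ 2) _ (nbhs `|g|)).
      exact: norm_continuous.
    exact: exprn_continuous.
  have JFg : J @ F --> J g by apply: cvg_trans (cJ) => P /= /Fg.
  apply/ler_addgt0Pr => e e0.
  apply: (@closed_cvg _ _ F _ J (fun y => y <= m + e) _ _ _ JFg).
    exact: closed_le.
  by apply: filterS (FB _ e0) => u /ltW.
exists g => h; apply/eqP; rewrite -subr_eq0; set c := phi h - _.
have Jt t : 0 <= - (t * c) + t ^+ 2 * `|h| ^+ 2 / 2.
  have := le_trans Jg (mJ (g + t *: h)).
  rewrite /J hdot_normD linearZr_LR linearD phiZ /= normrZ exprMn.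
  rewrite real_normK ?num_real// /c; lra.
have N0 : 0 < `|h| ^+ 2 + 1 by rewrite ltr_wpDl ?sqr_ge0.
have := Jt (c / (`|h| ^+ 2 + 1)).
set N := `|h| ^+ 2 in N0 *.
have -> : - (c / (N + 1) * c) + (c / (N + 1)) ^+ 2 * N / 2 =
    - (c ^+ 2 * (N + 2) / (2 * (N + 1) ^+ 2)) by field; rewrite gt_eqF.
rewrite oppr_ge0 pmulr_lle0 ?invr_gt0 ?mulr_gt0 ?exprn_gt0//.
rewrite pmulr_lle0; last by rewrite /N; have := sqr_ge0 `|h|; lra.
by move=> c0; rewrite -sqrf_eq0 eq_le c0 sqr_ge0.
Qed.

End hilbert_theory.

Section operators.
Context {R : realType} {X Y : hilbertType R}.

Definition bounded_operator (A : X -> Y) : Prop :=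
  exists M : R, forall x, `|A x| <= M * `|x|.

(* [get] picks the representative given by Riesz' theorem (unique by
   [hdot_sep]); see [adjointP] and [gradientP]. *)
Definition adjoint (A : X -> Y) (y : Y) : X :=
  get [set z : X | forall x, '[A x, y] = '[x, z]].

Definition gradient (f : X -> R) (x : X) : X :=
  get [set g : X | forall h, 'd f x h = '[g, h]].

Definition hessian (f : X -> R) (x : X) : X -> X := 'd (gradient f) x.

(* The last clause is continuity of the Hessian in operator norm. *)
Definition twice_continuously_differentiable (f : X -> R) : Prop :=
  [/\ forall x, differentiable f x,
      forall x, differentiable (gradient f) x &
      forall x (e : R), 0 < e -> \forall z \near x,
        forall h, `|hessian f z h - hessian f x h| <= e * `|h| ].

Lemma gradientP (f : X -> R) x :
  differentiable f x -> forall h, 'd f x h = '[gradient f x, h].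
Proof.
move=> /diff_continuous /riesz_representation fx.
exact: (@getPex _ [set g : X | forall h, 'd f x h = '[g, h]]).
Qed.

Lemma bounded_operator_continuous (A : {linear X -> Y}) :
  bounded_operator A -> continuous A.
Proof.
move=> [M AM]; apply/bounded_linear_continuous/linear_boundedP.
near=> r => x; apply: le_trans (AM x) _; apply: ler_wpM2r; first by [].
by near: r; apply: nbhs_pinfty_ge; rewrite num_real.
Unshelve. all: by end_near. Qed.

Lemma adjointP (A : {linear X -> Y}) :
  bounded_operator A -> forall x y, '[A x, y] = '[x, adjoint A y].
Proof.
move=> bA x y.
suff : exists z, forall x, '[A x, y] = '[x, z].
  by move/(@getPex _ [set z : X | forall x, '[A x, y] = '[x, z]]) => /(_ x).
have phil : linear (fun x => '[A x, y] : R).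
  by move=> a u v; rewrite linearP linearDl /= linearZl_LR.
pose phi : {linear X -> R} := HB.pack (fun x => '[A x, y] : R)
  (GRing.isLinear.Build _ _ _ _ _ phil).
have cphi : continuous phi.
  case: bA => M AM; apply/bounded_linear_continuous/linear_boundedP.
  near=> r => u; rewrite /phi /=.
  apply: le_trans (cauchy_schwarz _ _) _.
  apply: (@le_trans _ _ (M * `|u| * `|y|)); first exact: ler_wpM2r.
  rewrite mulrAC; apply: ler_wpM2r; first by [].
  by near: r; apply: nbhs_pinfty_ge; rewrite num_real.
have [z zP] := riesz_representation cphi.
by exists z => u; rewrite -[LHS]/(phi u) zP hdotC.
Unshelve. all: by end_near. Qed.

End operators.

(* Derivatives relative to a set [D]: one-sided at an endpoint of an interval,
   and independent of the values of [u] outside [D]. *)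
Section derivative_on.
Context {R : realType} {V : normedModType R}.
Implicit Types (D : set R) (u : R -> V).

Definition derivable_on D u (t : R) : Prop :=
  cvg ((s - t)^-1 *: (u s - u t) @[s --> within D t^']).

Definition derive_on D u (t : R) : V :=
  lim ((s - t)^-1 *: (u s - u t) @[s --> within D t^']).

Definition twice_derivable_on D u : Prop :=
  forall t, D t -> derivable_on D u t /\ derivable_on D (derive_on D u) t.

End derivative_on.

Section dynamics.
Context {R : realType} {X Y : hilbertType R}.
Variables (f : X -> R) (A : X -> Y) (b : Y) (rho : R).

Definition augmented_lagrangian (x : X) (y : Y) : R :=
  f x + '[y, A x - b] + rho / 2 * `|A x - b| ^+ 2.

Local Notation L := augmented_lagrangian.

Definition grad_x_lagrangian (x : X) (y : Y) : X := gradient (L^~ y) x.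

Definition grad_y_lagrangian (x : X) (y : Y) : Y := gradient (L x) y.

Definition hess_xx_lagrangian (x : X) (y : Y) : X -> X := hessian (L^~ y) x.

Definition is_solution (t0 alpha beta gamma r theta : R)
    (x : R -> X) (y : R -> Y) : Prop :=
  let D := `[t0, +oo[%classic in
  let x' := derive_on D x in let x'' := derive_on D x' in
  let y' := derive_on D y in let y'' := derive_on D y' in
  [/\ twice_derivable_on D x, twice_derivable_on D y &
      forall t, t0 <= t ->
        x'' t + (alpha / t) *: x' t
          + beta *: hess_xx_lagrangian (x t) (y t) (x' t)
          + (gamma + r / t) *:
              grad_x_lagrangian (x t) (y t + (theta * t) *: y' t) = 0
        /\
        y'' t + (alpha / t) *: y' t
          - (gamma + r / t) *:
              grad_y_lagrangian (x t + (theta * t) *: x' t) (y t) = 0].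

(* The normed-module norm of [X * Y] is the max norm, not the Hilbert one. *)
Definition prod_norm (s : X * Y) : R :=
  Num.sqrt (`|s.1| ^+ 2 + `|s.2| ^+ 2).

Definition energy (t0 beta gamma r xi eta : R) (xs : X) (ys : Y)
    (x : R -> X) (y : R -> Y) (t : R) : R :=
  let D := `[t0, +oo[%classic in
  let s : X * Y := (x t, y t) in
  let s' : X * Y := (derive_on D x t, derive_on D y t) in
  let ss : X * Y := (xs, ys) in
  2^-1 * prod_norm (t *: s' + xi *: (s - ss)) ^+ 2
  + eta / 2 * prod_norm (s - ss) ^+ 2
  + t * (gamma * t + r) * (L (x t) ys - L xs ys)
  + beta * xi * t * ('[gradient f (x t), x t - xs] - (f (x t) - f xs))
  + beta * xi * rho * t / 2 * `|A (x t) - b| ^+ 2.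

End dynamics.

(* Main.v *)
Require Import Defs.
From HB Require Import structures.
From mathcomp Require Import all_boot all_order all_algebra.
From mathcomp Require Import sesquilinear lra ring.
From mathcomp Require Import all_classical all_reals all_analysis.
Import Order.TTheory GRing.Theory Num.Theory.
Import numFieldNormedType.Exports.
Local Open Scope classical_set_scope.
Local Open Scope ring_scope.

Set Implicit Arguments.
Unset Strict Implicit.
Unset Printing Implicit Defensive.

(* The energy W is nonincreasing: with p = gamma t + r, the choice theta = 1/xi
   makes the coupling terms of the two equations cancel, and convexity makes
   every remaining term of W' nonpositive.  This bounds t p F, but only gives a
   bound on the square of the residual |A x - b|.  For the residual itself, the
   dual equation integrates exactly: z = t p (A x - b) satisfies z + I = B with
   B = z(t0) + xi (v - v(t0)) + eta (y - y(t0)), v = t y' + xi (y - y-star),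
   and I' = a z for some a >= 0, I(t0) = 0.  The energy bounds |B| by
   C0 - t p F; since |I + z| <= C0 forces |I| <= C0, this yields
   t p F + |z| <= 2 C0.

   The curves are only assumed differentiable on [t0, +oo[, so they are first
   prolonged to the left of t0 to be differentiable at t0 in the usual sense. *)

(** * Bilinearity of the inner product *)

Section hdot_linearity.
Context {R : realType} {H : hilbertType R}.
Implicit Types (u v w : H) (a : R).

Lemma hdotDl u v w : '[u + v, w] = '[u, w] + '[v, w].
Proof. by rewrite linearDl. Qed.

Lemma hdotDr u v w : '[u, v + w] = '[u, v] + '[u, w].
Proof. by rewrite !(hdotC u) hdotDl. Qed.

Lemma hdotZl a u w : '[a *: u, w] = a * '[u, w].
Proof. by rewrite linearZl_LR. Qed.

Lemma hdotZr a u w : '[u, a *: w] = a * '[u, w].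
Proof. by rewrite !(hdotC u) hdotZl. Qed.

Lemma hdotNl u w : '[- u, w] = - '[u, w].
Proof. by rewrite -scaleN1r hdotZl mulN1r. Qed.

Lemma hdotNr u w : '[u, - w] = - '[u, w].
Proof. by rewrite !(hdotC u) hdotNl. Qed.

Lemma hdotBl u v w : '[u - v, w] = '[u, w] - '[v, w].
Proof. by rewrite hdotDl hdotNl. Qed.

Lemma hdot0r u : '[u, 0] = 0.
Proof. by rewrite -(scale0r u) hdotZr mul0r. Qed.

Lemma hdot0l u : '[0, u] = 0.
Proof. by rewrite hdotC hdot0r. Qed.

End hdot_linearity.

(** * Differentiation rules along curves *)

Section curves.
Context {R : realType}.
Implicit Types (V W : normedModType R) (t : R).

(** Differentials carry the product rule for bilinear maps, so derivatives of curves are converted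
    to differentials and back. *)
Lemma is_derive_is_diff {V} (u : R -> V) t d :
  is_derive t 1 u d -> is_diff t u (fun h : R => h *: d).
Proof.
move=> [du <-]; have du' := (@derivable1_diffP _ _ u t).1 du.
by apply: DiffDef => //; rewrite diff1E // derive1E.
Qed.

Lemma is_diff_is_derive {V} (u : R -> V) t (du : R -> V) :
  is_diff t u du -> is_derive t 1 u (du 1).
Proof.
move=> [du1 <-]; apply: DeriveDef; first exact/derivable1_diffP.
by rewrite deriveE.
Qed.

Lemma is_derive_comp_diff {V W} (g : V -> W) (u : R -> V) t d :
  is_derive t 1 u d -> differentiable g (u t) ->
  is_derive t 1 (fun s => g (u s)) ('d g (u t) d).
Proof.
move=> /is_derive_is_diff ut gu.
have gu' : is_diff (u t) g ('d g (u t)) by apply: DiffDef.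
apply: is_derive_eq; first exact: is_diff_is_derive (is_diff_comp ut gu').
by rewrite /= scale1r.
Qed.

Lemma is_diff_bilinear {E U V W : normedModType R} (f : {bilinear U -> V -> W})
    (u du : E -> U) (v dv : E -> V) e :
  continuous (fun p => f p.1 p.2) -> is_diff e u du -> is_diff e v dv ->
  is_diff e (fun s => f (u s) (v s)) (fun h => f (du h) (v e) + f (u e) (dv h)).
Proof.
move=> cf ue ve; have uve := is_diff_pair ue ve.
have fuv : is_diff (u e, v e) (fun p => f p.1 p.2)
    (fun q => f (u e) q.2 + f q.1 (v e)).
  by apply: DiffDef; [exact: differentiable_bilin|rewrite diff_bilin].
apply: is_diff_eq; first exact: is_diff_comp uve fuv.
by apply/funext => h; rewrite /= addrC.
Qed.

Lemma is_derive_scale {V} (k : R -> R) (u : R -> V) t dk du :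
  is_derive t 1 k dk -> is_derive t 1 u du ->
  is_derive t 1 (fun s => k s *: u s) (dk *: u t + k t *: du).
Proof.
(* Scaling is a bilinear map once the scalars are seen as the normed module [R^o]. *)
have bil : bilinear_for (GRing.Scale.Law.clone _ _ *:%R _)
    (GRing.Scale.Law.clone _ _ *:%R _) (@GRing.scale R V : R^o -> V -> V).
  split=> [v a b c|a b v w] /=; first by rewrite scalerDl scalerA.
  by rewrite scalerDr !scalerA mulrC.
pose S : {bilinear R^o -> V -> V} := HB.pack (@GRing.scale R V : R^o -> V -> V)
  (bilinear_isBilinear.Build _ _ _ _ _ _ _ bil).
move=> /is_derive_is_diff kt /is_derive_is_diff ut.
have cS : continuous (fun p => S p.1 p.2) by move=> p; exact: scale_continuous.
apply: is_derive_eq; first exact: is_diff_is_derive (is_diff_bilinear cS kt ut).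
by rewrite /= !scale1r.
Qed.

Lemma is_diff_hdot {V} {H : hilbertType R} (u du v dv : V -> H) e :
  is_diff e u du -> is_diff e v dv ->
  is_diff e (fun s => '[u s, v s])
    (fun h => '[du h, v e] + '[u e, dv h]).
Proof.
have bil : bilinear_for (GRing.Scale.Law.clone _ _ *:%R _)
    (GRing.Scale.Law.clone _ _ *:%R _) (fun u v : H => '[u, v] : R^o).
  split=> [w a b c|w a b c] /=.
    by rewrite hdotDl hdotZl.
  by rewrite hdotDr hdotZr.
pose S : {bilinear H -> H -> R^o} := HB.pack (fun u v : H => '[u, v] : R^o)
  (bilinear_isBilinear.Build _ _ _ _ _ _ _ bil).
apply: (@is_diff_bilinear _ _ _ _ S) => p /=.
(* Polarization expresses the inner product by squared norms, which gives its joint continuity. *)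
have -> : (fun q : H * H => '[q.1, q.2]) =
    (fun q => (`|q.1 + q.2| ^+ 2 - `|q.1| ^+ 2 - `|q.2| ^+ 2) / 2).
  by apply/funext => q; rewrite hdot_normD; field.
have csq (k : H * H -> H) : {for p, continuous k} ->
    {for p, continuous (fun q => `|k q| ^+ 2)}.
  move=> ck.
  apply: (@continuous_comp _ _ _ (fun q => `|k q|) (fun a : R => a ^+ 2)).
    by apply: continuous_comp ck _; exact: norm_continuous.
  exact: exprn_continuous.
have c1 : {for p, continuous (@fst H H)} by exact: cvg_fst.
have c2 : {for p, continuous (@snd H H)} by exact: cvg_snd.
apply: cvgMr_tmp; apply: cvgB; last exact: csq.
by apply: cvgB; [apply: csq; exact: cvgD|exact: csq].
Qed.

Lemma is_derive_hdot {H : hilbertType R} (u v : R -> H) t du dv :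
  is_derive t 1 u du -> is_derive t 1 v dv ->
  is_derive t 1 (fun s => '[u s, v s]) ('[du, v t] + '[u t, dv]).
Proof.
move=> /is_derive_is_diff ut /is_derive_is_diff vt.
apply: is_derive_eq; first exact: is_diff_is_derive (is_diff_hdot ut vt).
by rewrite /= !scale1r.
Qed.

(** This rule and the next three are stated for pointwise functions, so that the derivatives
    assembled from them match the energy and its parts as they are written. *)
Lemma is_derive_const {V} (a : V) t : is_derive t 1 (fun=> a) 0.
Proof. exact: is_derive_cst. Qed.

Lemma is_derive_add {V} (f g : R -> V) t df dg :
  is_derive t 1 f df -> is_derive t 1 g dg ->
  is_derive t 1 (fun s => f s + g s) (df + dg).
Proof. exact: is_deriveD. Qed.

Lemma is_derive_sub {V} (f g : R -> V) t df dg :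
  is_derive t 1 f df -> is_derive t 1 g dg ->
  is_derive t 1 (fun s => f s - g s) (df - dg).
Proof. exact: is_deriveB. Qed.

Lemma is_derive_mul (f g : R -> R) t df dg :
  is_derive t 1 f df -> is_derive t 1 g dg ->
  is_derive t 1 (fun s => f s * g s) (df * g t + f t * dg).
Proof. exact: is_derive_scale. Qed.

Lemma is_derive_normsq {H : hilbertType R} (u : R -> H) t du :
  is_derive t 1 u du -> is_derive t 1 (fun s => `|u s| ^+ 2) (2 * '[u t, du]).
Proof.
move=> ut; under [fun s => _]funext do rewrite -hdot_norm.
by apply: is_derive_eq; [exact: is_derive_hdot|rewrite hdotC mulr2n mulrDl !mul1r].
Qed.

Lemma is_derive_bounded_operator {X Y : hilbertType R} (A : {linear X -> Y})
    (u : R -> X) t du :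
  bounded_operator A -> is_derive t 1 u du ->
  is_derive t 1 (fun s => A (u s)) (A du).
Proof.
move=> /bounded_operator_continuous cA ut.
apply: is_derive_eq; first exact: is_derive_comp_diff (linear_differentiable _ cA).
by rewrite diff_lin.
Qed.

Lemma is_derive_gradient {X : hilbertType R} (f : X -> R) (g : X) (u : R -> X) t du :
  differentiable f (u t) -> (forall h, 'd f (u t) h = '[g, h]) ->
  is_derive t 1 u du -> is_derive t 1 (fun s => f (u s)) '[g, du].
Proof.
move=> fu fg ut; apply: is_derive_eq; first exact: is_derive_comp_diff fu.
exact: fg.
Qed.

Lemma derive_le0_antitone (W dW : R -> R) (t0 : R) :
  (forall t, t0 <= t -> is_derive t 1 W (dW t)) ->
  (forall t, t0 <= t -> dW t <= 0) ->
  forall t, t0 <= t -> W t <= W t0.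
Proof.
move=> WdW dW0 t t0t.
apply: (@ler0_derive1_le_cc _ W t0 t) => //; rewrite ?in_itv/= ?lexx ?t0t//.
- by move=> s; rewrite in_itv/= => /andP[/ltW/WdW[]].
- move=> s; rewrite in_itv/= => /andP[/ltW t0s _]; rewrite derive1E.
  have [_ ->] := WdW s t0s; exact: dW0 _ t0s.
- apply: derivable_within_continuous => s; rewrite in_itv/= => /andP[t0s _].
  by case: (WdW s t0s).
Qed.

End curves.

(** * From one-sided to two-sided derivatives *)

Section extension.
Context {R : realType} {V : normedModType R}.

(* Prolonging [u] to the left of [t0] by its tangent makes the one-sided
   derivative at [t0] a genuine one. *)
Lemma derivable_on_extension (u : R -> V) (t0 : R) :
  let D := `[t0, +oo[%classic in
  (forall t, t0 <= t -> derivable_on D u t) ->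
  exists2 w : R -> V, forall t, t0 <= t -> w t = u t &
    forall t, t0 <= t -> is_derive t 1 w (derive_on D u t).
Proof.
move=> D du.
have Dt t : t0 <= t -> D t by move=> ?; rewrite /D /= in_itv/= andbT.
pose w t := if t0 <= t then u t else u t0 + (t - t0) *: derive_on D u t0.
have wu t : t0 <= t -> w t = u t by rewrite /w => ->.
exists w => // t t0t.
set d := derive_on D u t.
have wd : (s - t)^-1 *: (w s - w t) @[s --> t^'] --> d.
  have := du t t0t; rewrite /derivable_on => /cvgrPdist_lt ud.
  apply/cvgrPdist_lt => e e0; have := ud e e0.
  rewrite nbhs_simpl /within/= => ude.
  (* For [t0 < t] a small neighbourhood avoids the prolonged branch; only at [t = t0] is the tangent
     met, and there its difference quotient equals [d]. *)
  have near_t : \forall s \near t^', t0 <= s \/ t = t0.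
    have [->|tt0] := eqVneq t t0; first by near=> s; right.
    have {}tt0 : t0 < t by rewrite lt_neqAle eq_sym tt0.
    by near=> s; left; apply: ltW; near: s; apply: nbhs_dnbhs; exact: lt_nbhsr.
  near=> s.
  have [t0s|st0] := leP t0 s.
    rewrite !wu//; have := Dt _ t0s; near: s; exact: ude.
  have [| tt0] : t0 <= s \/ t = t0 by near: s.
    by rewrite leNgt st0.
  rewrite (wu t)// /w leNgt st0/= -/d tt0 addrAC subrr add0r scalerA.
  by rewrite mulVf ?subr_eq0 ?lt_eqF// /d tt0 scale1r subrr normr0.
(* [is_derive] is phrased with the increment [h = s - t], so the limit is recentred at 0. *)
have : h^-1 *: ((w \o shift t) (h *: (1 : R)) - w t) @[h --> (0 : R)^'] --> d.
  apply/cvgrPdist_lt => e e0; move/cvgrPdist_lt : wd => /(_ e e0).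
  rewrite /dnbhs !near_withinE => /nbhs_ballP[del del0 tP].
  apply/nbhs_ballP; exists del => // h; rewrite -ball_normE /= sub0r => hdel h0.
  have := tP (h + t); rewrite -ball_normE /= opprD addrCA subrr addr0.
  rewrite -[h + t == t]subr_eq0 addrK [h *: 1]mulr1.
  exact.
by move=> wd'; apply: DeriveDef; [apply/cvg_ex; exists d|exact: cvg_lim wd'].
Unshelve. all: by end_near. Qed.

End extension.

(** * Convexity: tangent inequality, monotone gradient, nonnegative Hessian *)

Lemma is_derive_le_slope {R : realType} (phi : R -> R) (d c : R) :
  is_derive (0 : R) 1 phi d ->
  (forall s, 0 < s -> s <= 1 -> phi s - phi 0 <= s * c) -> d <= c.
Proof.
move=> [dphi <-] phic.
(* The difference quotients are bounded for [s] in (0,1] only, so the two-sided limit is restricted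
   to the right of 0. *)
have cR := cvg_dnbhs_at_right dphi.
apply: (@closed_cvg _ _ (0^'+ : set_system R) _ _ (fun z => z <= c) _ _ _ cR).
  exact: closed_le.
near=> h.
have h0 : 0 < h by near: h; exact: nbhs_right_gt.
have h1 : h <= 1 by near: h; apply: nbhs_right_le; exact: ltr01.
by rewrite /= [h *: 1]mulr1 addr0 -[_ *: _]/(h^-1 * (phi h - phi 0)) ler_pdivrMl// phic.
Unshelve. all: by end_near. Qed.

Lemma is_derive_segment {R : realType} {V : normedModType R} (u h : V) (s : R) :
  is_derive s 1 (fun s : R => u + s *: h) h.
Proof.
have := is_derive_scale (is_derive_id s 1) (is_derive_cst h s 1).
rewrite scale1r scaler0 addr0 => sh.
by have := is_deriveD (is_derive_cst u s 1) sh; rewrite add0r.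
Qed.

Section convexity.
Context {R : realType} {X : hilbertType R} (f : X -> R) (g : X -> X).
Hypothesis f_convex : convex_function (setT : set (convex_lmodType X)) f.
Hypothesis df : forall u, differentiable f u.
Hypothesis dfg : forall u h, 'd f u h = '[g u, h].

(** On the segment from [u] to [v], convexity bounds each difference quotient at 0 by [f v - f u];
    the derivative inherits the bound. *)
Lemma convex_gradient_le u v : f u + '[g u, v - u] <= f v.
Proof.
rewrite -lerBrDl.
have segm := is_derive_segment u (v - u) 0.
have := is_derive_gradient (df _) (dfg _) segm; rewrite scale0r addr0.
move=> /is_derive_le_slope; apply => s s0 s1; rewrite scale0r addr0.
have fs : f (s *: v + (1 - s) *: u) <= s * f v + (1 - s) * f u :=
  @f_convex (Itv01 (ltW s0) s1) v u (mem_set I) (mem_set I).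
rewrite (_ : u + s *: (v - u) = s *: v + (1 - s) *: u); first lra.
by rewrite scalerBr scalerBl scale1r addrCA addrA addrAC -addrA; congr (_ + _).
Qed.

Lemma convex_gradient_monotone u v : 0 <= '[g v - g u, v - u].
Proof.
have := convex_gradient_le u v; have := convex_gradient_le v u.
rewrite -[u - v]opprB hdotNr hdotBl; lra.
Qed.

(** Monotonicity of [g] makes the difference quotients of ['[g (u + s *: h), h]] nonnegative for
    [s > 0]. The slope bound is applied to the opposite function with slope 0. *)
Lemma convex_hessian_ge0 u h k :
  is_derive (0 : R) 1 (fun s : R => g (u + s *: h)) k -> 0 <= '[k, h].
Proof.
move=> gs; rewrite -oppr_le0.
have := is_deriveN (is_derive_hdot gs (is_derive_cst h (0 : R) 1)).
rewrite hdot0r addr0 => /is_derive_le_slope; apply => s s0 _.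
have := convex_gradient_monotone u (u + s *: h).
rewrite addrAC subrr add0r hdotZr hdotBl pmulr_rge0// !fctE scale0r addr0.
by rewrite mulr0 opprK -oppr_le0 opprB addrC.
Qed.

End convexity.

(** * Gradients and Hessian of the augmented Lagrangian *)

Lemma gradient_eq {R : realType} {X : hilbertType R} (f : X -> R) (u g : X) :
  is_diff u f (fun h => '[g, h]) -> gradient f u = g.
Proof.
(* [gradient] is a chosen representative; inner products separate vectors, so any vector
   representing the differential equals it. *)
move=> [fu dfu]; apply: hdot_sep => h.
by rewrite -gradientP// dfu.
Qed.

Section lagrangian.
Context {R : realType} {X Y : hilbertType R} (A : {linear X -> Y}).
Hypothesis A_bounded : bounded_operator A.

Lemma hdot_adjoint (u : X) (v : Y) : '[A u, v] = '[adjoint A v, u].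
Proof. by rewrite (hdotC _ u) (adjointP A_bounded). Qed.

Lemma is_diff_bounded_operator (u : X) : is_diff u A A.
Proof.
have cA := bounded_operator_continuous A_bounded.
by apply: DiffDef; [exact: linear_differentiable|exact: diff_lin].
Qed.

Lemma adjoint_linear : linear (adjoint A).
Proof.
move=> a u v; apply: hdot_sep => h.
by rewrite hdotDl hdotZl -!hdot_adjoint hdotDr hdotZr.
Qed.

(** Testing [adjoint A v] against itself gives [|A* v|^2 = <A A* v, v> <= |M| |A* v| |v|]. The bound
    is [|M|] because the sign of [M] is not given. *)
Lemma adjoint_bounded : bounded_operator (adjoint A).
Proof.
have [M AM] := A_bounded; exists `|M| => v.
have [->|v0] := eqVneq (adjoint A v) 0; first by rewrite normr0 mulr_ge0.
rewrite -(@ler_pM2l _ `|adjoint A v|) ?normr_gt0// -expr2 -hdot_norm -hdot_adjoint.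
apply: le_trans (ler_norm _) _; apply: le_trans (cauchy_schwarz _ _) _.
rewrite mulrA; apply: ler_wpM2r => //; apply: le_trans (AM _) _.
by rewrite mulrC; apply: ler_wpM2l => //; exact: ler_norm.
Qed.

End lagrangian.

Lemma is_diff_adjoint {R : realType} {X Y : hilbertType R} (A : {linear X -> Y})
  (v : Y) : bounded_operator A -> is_diff v (adjoint A) (adjoint A).
Proof.
move=> bA; pose As : {linear Y -> X} := HB.pack (adjoint A)
  (GRing.isLinear.Build _ _ _ _ _ (adjoint_linear bA)).
exact: (@is_diff_bounded_operator _ _ _ As (adjoint_bounded bA)).
Qed.

Section lagrangian_gradients.
Context {R : realType} {X Y : hilbertType R}.
Variables (f : X -> R) (A : {linear X -> Y}) (b : Y) (rho : R).
Hypothesis A_bounded : bounded_operator A.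
Hypothesis df : forall u, differentiable f u.
Hypothesis ddf : forall u, differentiable (gradient f) u.

Lemma lagrangianE u v : augmented_lagrangian f A b rho u v =
  f u + '[v, A u - b] + rho / 2 * '[A u - b, A u - b].
Proof. by rewrite /augmented_lagrangian hdot_norm. Qed.

Let is_diff_residual u : is_diff u (fun z => A z - b) A.
Proof.
have := is_diffB (is_diff_bounded_operator A_bounded u) (is_diff_cst b u).
by move=> /is_diff_eq; apply; apply/funext => h; rewrite /= subr0.
Qed.

Lemma grad_x_lagrangianE u v : grad_x_lagrangian f A b rho u v =
  gradient f u + adjoint A v + rho *: adjoint A (A u - b).
Proof.
apply: gradient_eq.
(* Writing [v] as a constant function lets the product rule for [hdot] treat both pairings. *)
have -> : (augmented_lagrangian f A b rho)^~ v =
    f + (fun z => '[cst v z, A z - b])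
      + (rho / 2) *: (fun z => '[A z - b, A z - b]).
  by apply/funext => z; rewrite lagrangianE.
have fu : is_diff u f (fun h => '[gradient f u, h]).
  by apply: DiffDef => //; apply/funext => h; rewrite gradientP//.
have ru := is_diff_residual u.
have := is_diffD (is_diffD fu (is_diff_hdot (is_diff_cst v u) ru))
  (is_diffZ (rho / 2) (is_diff_hdot ru ru)).
move=> /is_diff_eq; apply; apply/funext => h.
rewrite !fctE /= hdot0l.
rewrite (hdotDl _ (rho *: _)) (hdotDl (gradient f u)) hdotZl.
rewrite -!(hdot_adjoint A_bounded) (hdotC v) (hdotC (A u - b)).
rewrite -[_ *: _]/(rho / 2 * ('[A h, A u - b] + '[A h, A u - b])).
by field.
Qed.

Lemma grad_y_lagrangianE u v : grad_y_lagrangian f A b rho u v = A u - b.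
Proof.
apply: gradient_eq.
have -> : augmented_lagrangian f A b rho u =
    (fun w => '[id w, cst (A u - b) w])
      + cst (f u + rho / 2 * '[A u - b, A u - b]).
  by apply/funext => w; rewrite lagrangianE /= !fctE; ring.
have := is_diffD (is_diff_hdot (is_diff_id v) (is_diff_cst (A u - b) v))
  (is_diff_cst (f u + rho / 2 * '[A u - b, A u - b]) v).
move=> /is_diff_eq; apply; apply/funext => h.
by rewrite !fctE /= hdot0r !addr0 hdotC.
Qed.

Lemma hess_xx_lagrangianE u v h : hess_xx_lagrangian f A b rho u v h =
  hessian f u h + rho *: adjoint A (A h).
Proof.
rewrite /hess_xx_lagrangian /hessian.
have -> : gradient ((augmented_lagrangian f A b rho)^~ v) =
    gradient f + cst (adjoint A v)
      + rho *: (fun z => adjoint A (A z - b)).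
  by apply/funext => z; exact: grad_x_lagrangianE.
have gu : is_diff u (gradient f) ('d (gradient f) u) by apply: DiffDef.
have ru := is_diff_comp (is_diff_residual u)
  (is_diff_adjoint (A u - b) A_bounded).
have [_ ->] := is_diffD (is_diffD gu (is_diff_cst (adjoint A v) u))
  (is_diffZ rho ru).
by rewrite !fctE /= addr0.
Qed.

End lagrangian_gradients.

(* [e] is an integrating factor: (e I)' = a e (I + z), so e' = a e >= 0 bounds
   the growth of [e I] by that of [C e]. *)
Lemma averaged_bound {R : realType} {H : hilbertType R} (z I : R -> H)
    (a e : R -> R) (C t0 : R) :
  (forall t, t0 <= t -> is_derive t 1 I (a t *: z t)) ->
  (forall t, t0 <= t -> is_derive t 1 e (a t * e t)) ->
  (forall t, t0 <= t -> 0 <= a t) -> (forall t, t0 <= t -> 0 < e t) ->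
  I t0 = 0 -> 0 <= C -> (forall t, t0 <= t -> `|I t + z t| <= C) ->
  forall t, t0 <= t -> `|I t| <= C.
Proof.
move=> dI de a0 e0 It0 C0 zI T t0T.
have [->|IT0] := eqVneq (I T) 0; first by rewrite normr0.
rewrite -normr_gt0 in IT0.
(* Pairing with the fixed vector [I T] avoids differentiating a norm. The derivative is
   [a e (<I + z, I T> - C |I T|)], nonpositive by Cauchy-Schwarz, and the value at [t0] is
   nonpositive as [I t0 = 0]. *)
have : e T * ('[I T, I T] - C * `|I T|)
    <= e t0 * ('[I t0, I T] - C * `|I T|).
  apply: (@derive_le0_antitone _ (fun s => e s * ('[I s, I T] - C * `|I T|))
    (fun s => a s * e s * ('[I s + z s, I T] - C * `|I T|))) => // s t0s.
    have dIT := is_derive_hdot (dI s t0s) (is_derive_const (I T) s).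
    rewrite hdot0r addr0 in dIT.
    have dITC := is_derive_sub dIT (is_derive_const (C * `|I T|) s).
    apply: is_derive_eq; first exact: is_derive_mul (de s t0s) dITC.
    by rewrite hdotDl hdotZl; ring.
  apply: mulr_ge0_le0; first by rewrite mulr_ge0 ?a0 ?(ltW (e0 _ _)).
  rewrite subr_le0; apply: le_trans (ler_norm _) _; apply: le_trans (cauchy_schwarz _ _) _.
  by apply: ler_wpM2r => //; exact: zI.
rewrite It0 hdot0l sub0r hdot_norm => eT; rewrite -(@ler_pM2r _ `|I T|)// -expr2 -subr_le0.
rewrite -(@pmulr_rle0 _ (e T)) ?e0//; apply: le_trans eT _.
by rewrite mulrN oppr_le0 !mulr_ge0 ?(ltW (e0 _ _)).
Qed.

(** * Decay of the energy and bound on the residual *)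

Section energy_estimate.
Context {R : realType} {X Y : hilbertType R}.
Variables (A : {linear X -> Y}) (As : Y -> X).
Hypothesis A_bounded : bounded_operator A.
Hypothesis dot_As : forall u v, '[A u, v] = '[As v, u].
Variables (t0 alpha beta gamma r theta xi rho : R).
Hypotheses (t0_gt0 : 0 < t0) (beta_gt0 : 0 < beta) (gamma_gt0 : 0 < gamma)
  (r_ge_beta : beta <= r) (xi_theta : xi * theta = 1) (xi_ge2 : 2 <= xi)
  (xi_le : xi <= alpha - 1) (rho_gt0 : 0 < rho).
(* [e = x - xs], [w = y - ys], [q = gradient f x], [k = hessian f x (de)] and
   [phi = f x - f xs], abstracted because unification unfolds [gradient]. *)
Variables (e de dde q k : R -> X) (w dw ddw : R -> Y) (phi : R -> R) (ys : Y).
Hypothesis e_de : forall t, t0 <= t -> is_derive t 1 e (de t).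
Hypothesis de_dde : forall t, t0 <= t -> is_derive t 1 de (dde t).
Hypothesis w_dw : forall t, t0 <= t -> is_derive t 1 w (dw t).
Hypothesis dw_ddw : forall t, t0 <= t -> is_derive t 1 dw (ddw t).
Hypothesis q_k : forall t, t0 <= t -> is_derive t 1 q (k t).
Hypothesis phi_q : forall t, t0 <= t -> is_derive t 1 phi '[q t, de t].
Hypothesis phi_le : forall t, t0 <= t -> phi t <= '[q t, e t].
Hypothesis phi_ge : forall t, t0 <= t -> 0 <= phi t + '[ys, A (e t)].
Hypothesis k_ge0 : forall t, t0 <= t -> 0 <= '[k t, de t].
Hypothesis ode_e : forall t, t0 <= t ->
  dde t + (alpha / t) *: de t + beta *: (k t + rho *: As (A (de t)))
  + (gamma + r / t) *:
    (q t + As (ys + w t + (theta * t) *: dw t) + rho *: As (A (e t))) = 0.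
Hypothesis ode_w : forall t, t0 <= t ->
  ddw t + (alpha / t) *: dw t
  - (gamma + r / t) *: A (e t + (theta * t) *: de t) = 0.

Implicit Types t : R.

Let p t := gamma * t + r.
Let eta := xi * (alpha - 1 - xi).
(** [u] and [v] are the two components of the vector whose squared norm opens the energy. *)
Let u t := t *: de t + xi *: e t.
Let v t := t *: dw t + xi *: w t.
Let F t := phi t + '[ys, A (e t)] + rho / 2 * `|A (e t)| ^+ 2.
Let W t := 2^-1 * (`|u t| ^+ 2 + `|v t| ^+ 2)
  + eta / 2 * (`|e t| ^+ 2 + `|w t| ^+ 2) + t * p t * F t
  + beta * xi * t * ('[q t, e t] - phi t)
  + beta * xi * rho * t / 2 * `|A (e t)| ^+ 2.

Let t_gt0 t : t0 <= t -> 0 < t.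
Proof. exact: lt_le_trans. Qed.


(** The first equation times [t] eliminates [dde]. Since [xi * theta = 1], the extrapolated
    multiplier is [ys + theta *: v t]. *)
Let u_deriv t : t0 <= t -> is_derive t 1 u
  ((1 + xi - alpha) *: de t - (beta * t) *: (k t + rho *: As (A (de t)))
  - p t *: (q t + As (ys + theta *: v t) + rho *: As (A (e t)))).
Proof.
move=> t0t; have tt := t_gt0 t0t.
have := is_derive_add (is_derive_scale (is_derive_id t 1) (de_dde t0t))
  (is_deriveZ xi (e_de t0t)).
move=> /is_derive_eq; apply.
have -> : ys + theta *: v t = ys + w t + (theta * t) *: dw t.
  by rewrite /v scalerDr !scalerA mulrC (mulrC theta xi) xi_theta scale1r
    -addrA (addrC (w t)).
set G := As (ys + _ + _); apply: hdot_sep => h.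
have := congr1 (fun z => '[z, h]) (ode_e t0t); rewrite -/G /=.
rewrite hdot0l !(hdotDl, hdotNl, hdotZl) /= => /eqP; rewrite -!addrA addr_eq0 => /eqP ->.
rewrite /p; field; exact: lt0r_neq0.
Qed.

(** Likewise the extrapolated primal error is [theta *: u t], so the two equations are coupled
    skew-symmetrically through [u] and [v]. *)
Let v_deriv t : t0 <= t -> is_derive t 1 v
  ((1 + xi - alpha) *: dw t + p t *: (theta *: A (u t))).
Proof.
move=> t0t; have tt := t_gt0 t0t.
have := is_derive_add (is_derive_scale (is_derive_id t 1) (dw_ddw t0t))
  (is_deriveZ xi (w_dw t0t)).
move=> /is_derive_eq; apply.
have -> : theta *: A (u t) = A (e t + (theta * t) *: de t).
  by rewrite -linearZ scalerDr !scalerA (mulrC theta xi) xi_theta scale1r addrC.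
set G := A _; apply: hdot_sep => h.
have := congr1 (fun z => '[z, h]) (ode_w t0t); rewrite -/G /=.
rewrite hdot0l !(hdotDl, hdotNl, hdotZl) /= => /eqP; rewrite -!addrA addr_eq0 => /eqP ->.
rewrite /p; field; exact: lt0r_neq0.
Qed.

Let F_deriv t : t0 <= t -> is_derive t 1 F
  ('[q t, de t] + '[ys, A (de t)] + rho * '[A (e t), A (de t)]).
Proof.
move=> t0t; have dA := is_derive_bounded_operator A_bounded (e_de t0t).
have := is_derive_add (is_derive_add (phi_q t0t) (is_derive_hdot (is_derive_const ys t) dA))
  (is_derive_mul (is_derive_const (rho / 2) t) (is_derive_normsq dA)).
by move=> /is_derive_eq; apply; rewrite hdot0l; field.
Qed.

Let dW t := - ((alpha - 1 - xi) * t * (`|de t| ^+ 2 + `|dw t| ^+ 2))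
  - beta * t ^+ 2 * ('[k t, de t] + rho * `|A (de t)| ^+ 2)
  - ((xi - 2) * gamma * t + (xi - 1) * r) * F t
  - (p t - beta) * xi * ('[q t, e t] - phi t + rho / 2 * `|A (e t)| ^+ 2).

Let p_deriv t : is_derive t 1 p gamma.
Proof.
have := is_derive_add (is_derive_mul (is_derive_const gamma t) (is_derive_id t 1))
  (is_derive_const r t).
by move=> /is_derive_eq; apply; ring.
Qed.

Let tp_deriv t : is_derive t 1 (fun s => s * p s) (2 * gamma * t + r).
Proof.
have := is_derive_mul (is_derive_id t 1) (p_deriv t).
by move=> /is_derive_eq; apply; rewrite /p /=; ring.
Qed.

(** The value of [eta] cancels [<e, de>] and [<w, dw>]; the derivative of [F] cancels the pairings
    of [de] with the gradient terms; the last two summands of [W] cancel [<k, e>] and [<A e, A de>]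
    coming from the Hessian damping. *)
Let W_deriv t : t0 <= t -> is_derive t 1 W (dW t).
Proof.
move=> t0t; have dA := is_derive_bounded_operator A_bounded (e_de t0t).
have c a := is_derive_const (a : R) t.
have du := is_derive_normsq (u_deriv t0t); have dv := is_derive_normsq (v_deriv t0t).
have dEn := is_derive_add (is_derive_normsq (e_de t0t)) (is_derive_normsq (w_dw t0t)).
have dD := is_derive_sub (is_derive_hdot (q_k t0t) (e_de t0t)) (phi_q t0t).
have ct a := is_derive_mul (c a) (is_derive_id t 1).
have ct2 a := is_derive_mul (ct a) (c 2^-1).
have := is_derive_add (is_derive_add (is_derive_add (is_derive_add
  (is_derive_mul (c 2^-1) (is_derive_add du dv))
  (is_derive_mul (c (eta / 2)) dEn))
  (is_derive_mul (tp_deriv t) (F_deriv t0t)))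
  (is_derive_mul (ct (beta * xi)) dD))
  (is_derive_mul (ct2 (beta * xi * rho)) (is_derive_normsq dA)).
move=> /is_derive_eq; apply.
have dotrAs a m : '[a, As m] = '[A a, m] by rewrite dot_As hdotC.
have Au : A (u t) = t *: A (de t) + xi *: A (e t) by rewrite linearD !linearZ.
rewrite !(hdotDr, hdotNr, hdotZr) !dotrAs (hdotDr _ ys) (hdotZr theta).
(* The coupling term occurs with opposite signs, hence stays an unexpanded atom. *)
rewrite (hdotC (v t) (A _)); move: '[A (u t), v t] => uv.
rewrite Au /u /v !(hdotDl, hdotZl).
rewrite (hdotC (de t) (q t)) (hdotC (de t) (k t)) (hdotC (e t) (q t)).
rewrite (hdotC (e t) (k t)) (hdotC (A (de t)) ys) (hdotC (A (e t)) ys).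
rewrite (hdotC (A (de t)) (A (e t))) /F /dW /F /p /eta -!hdot_norm.
by field.
Qed.

(** The four subtracted terms are nonnegative by, in order, [xi_le], [k_ge0], [xi_ge2] with
    [phi_ge], and [r_ge_beta] with [phi_le]. *)
Let dW_le0 t : t0 <= t -> dW t <= 0.
Proof.
move: beta_gt0 r_ge_beta xi_ge2 => b0 rb xi2 t0t; have tt := t_gt0 t0t.
have gt : 0 < gamma * t by exact: mulr_gt0.
have F0 : 0 <= F t by rewrite addr_ge0 ?phi_ge// mulr_ge0 ?sqr_ge0// divr_ge0// ltW.
have D0 : 0 <= '[q t, e t] - phi t + rho / 2 * `|A (e t)| ^+ 2.
  by rewrite addr_ge0 ?subr_ge0 ?phi_le// mulr_ge0 ?sqr_ge0// divr_ge0// ltW.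
have K0 : 0 <= '[k t, de t] + rho * `|A (de t)| ^+ 2.
  by rewrite addr_ge0 ?k_ge0// mulr_ge0 ?sqr_ge0// ltW.
have s1 : 0 <= (alpha - 1 - xi) * t * (`|de t| ^+ 2 + `|dw t| ^+ 2).
  rewrite mulr_ge0 ?addr_ge0 ?sqr_ge0// mulr_ge0//; last exact: ltW.
  by rewrite subr_ge0.
have s2 : 0 <= beta * t ^+ 2 * ('[k t, de t] + rho * `|A (de t)| ^+ 2).
  by rewrite !mulr_ge0 ?sqr_ge0// ltW.
have s3 : 0 <= ((xi - 2) * gamma * t + (xi - 1) * r) * F t.
  apply: mulr_ge0 => //; rewrite -mulrA.
  apply: addr_ge0; apply: mulr_ge0; [lra|exact: ltW|lra|lra].
have s4 : 0 <= (p t - beta) * xi *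
    ('[q t, e t] - phi t + rho / 2 * `|A (e t)| ^+ 2).
  by rewrite !mulr_ge0// /p; lra.
rewrite /dW; lra.
Qed.

Let W_le t : t0 <= t -> W t <= W t0.
Proof. exact: (derive_le0_antitone W_deriv dW_le0). Qed.

Let W_ge t : t0 <= t -> 2^-1 * (`|u t| ^+ 2 + `|v t| ^+ 2)
  + eta / 2 * (`|e t| ^+ 2 + `|w t| ^+ 2) + t * p t * F t <= W t.
Proof.
move: beta_gt0 xi_ge2 rho_gt0 => b0 xi2 rho0 t0t; have tt := t_gt0 t0t.
have D0 : 0 <= beta * xi * t * ('[q t, e t] - phi t).
  by rewrite !mulr_ge0 ?subr_ge0 ?phi_le//; lra.
have A0 : 0 <= beta * xi * rho * t / 2 * `|A (e t)| ^+ 2.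
  by rewrite !mulr_ge0 ?sqr_ge0//; lra.
rewrite /W; lra.
Qed.

(* [B] is an antiderivative of p A u by [ode_w], hence I' = (xi p - (t p)') A e,
   a nonnegative multiple of [z]. *)
Let z t := (t * p t) *: A (e t).
Let B t := z t0 + xi *: (v t - v t0 + (alpha - 1 - xi) *: (w t - w t0)).
Let I t := B t - z t.

Let I_deriv t : t0 <= t ->
  is_derive t 1 I (((xi * p t - (2 * gamma * t + r)) / (t * p t)) *: z t).
Proof.
move: beta_gt0 r_ge_beta xi_ge2 => b0 rb xi2 t0t; have tt := t_gt0 t0t.
have pt : 0 < p t by rewrite /p; have := mulr_gt0 gamma_gt0 tt; lra.
have dA := is_derive_bounded_operator A_bounded (e_de t0t).
have dv := is_derive_sub (v_deriv t0t) (is_derive_const (v t0) t).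
have dw' := is_derive_scale (is_derive_const (alpha - 1 - xi) t)
  (is_derive_sub (w_dw t0t) (is_derive_const (w t0) t)).
have dB := is_derive_add (is_derive_const (z t0) t)
  (is_derive_scale (is_derive_const xi t) (is_derive_add dv dw')).
have := is_derive_sub dB (is_derive_scale (tp_deriv t) dA).
move=> /is_derive_eq; apply; apply: hdot_sep => h.
have -> : A (u t) = t *: A (de t) + xi *: A (e t) by rewrite linearD !linearZ.
rewrite /z !(hdotDl, hdotNl, hdotZl, hdot0l).
have -> : theta = xi^-1 by rewrite -[xi^-1]mulr1 -xi_theta mulKf// gt_eqF; lra.
by field; rewrite !gt_eqF//=; lra.
Qed.

Let eta_ge0 : 0 <= eta.
Proof. by rewrite /eta mulr_ge0 ?subr_ge0// (le_trans _ xi_ge2). Qed.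

Let C := 2 * W t0 + xi ^+ 2 + eta + t0 * p t0 * `|A (e t0)|.

(** Young's inequality at [t] and at [t0] costs [xi ^+ 2 / 2 + eta / 2] each time and leaves parts
    of [W t] and [W t0], together at most [2 * W t0]; adding [|z t0|] yields [C]. *)
Let B_le t : t0 <= t -> `|B t| <= C - t * p t * F t.
Proof.
move: xi_ge2 eta_ge0 t0_gt0 r_ge_beta beta_gt0 => xi2 eta0 t00 rb b0 t0t.
have xi0 : 0 <= xi by lra.
have gt0 : 0 < gamma * t0 by exact: mulr_gt0.
have zt0 : `|z t0| = t0 * p t0 * `|A (e t0)|.
  by rewrite normrZ ger0_norm// mulr_ge0 ?(ltW t00)// /p; lra.
have Bt : `|B t| <= `|z t0| + xi * (`|v t| + `|v t0|) + eta * (`|w t| + `|w t0|).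
  rewrite /B scalerDr scalerA -/eta addrA.
  apply: le_trans (ler_normD _ _) _; rewrite (normrZ eta) (ger0_norm eta0).
  apply: lerD; last by apply: ler_wpM2l => //; exact: ler_normB.
  apply: le_trans (ler_normD _ _) _; rewrite (normrZ xi) (ger0_norm xi0).
  by rewrite lerD2l ler_wpM2l ?ler_normB.
have young s : t0 <= s -> xi * `|v s| + eta * `|w s| <=
    xi ^+ 2 / 2 + eta / 2 + 2^-1 * (`|u s| ^+ 2 + `|v s| ^+ 2)
    + eta / 2 * (`|e s| ^+ 2 + `|w s| ^+ 2).
  move=> _; have := sqr_ge0 (xi - `|v s|); have := sqr_ge0 `|u s|.
  have := mulr_ge0 eta0 (sqr_ge0 (1 - `|w s|)).
  have := mulr_ge0 eta0 (sqr_ge0 `|e s|).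
  nra.
have := young t t0t; have := young t0 (lexx t0).
have F0 : 0 <= t0 * p t0 * F t0.
  apply: mulr_ge0; first by rewrite mulr_ge0 ?(ltW t00)// /p; lra.
  by rewrite addr_ge0 ?phi_ge// mulr_ge0 ?sqr_ge0// divr_ge0// ltW.
have := W_ge t0t; have := W_ge (lexx t0); have := W_le t0t.
rewrite /C -zt0.
move: (t * p t * F t) (t0 * p t0 * F t0) F0 => a a0 F0.
lra.
Qed.

(** The weight solves [e' / e = (xi - 1) / t - gamma / p], which is the coefficient in [I_deriv]
    because [(t p)' = p + gamma t]. *)
Let weight_deriv t : t0 <= t -> is_derive t 1 (fun s => s `^ (xi - 1) * (p s)^-1)
  ((xi * p t - (2 * gamma * t + r)) / (t * p t) * (t `^ (xi - 1) * (p t)^-1)).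
Proof.
move: r_ge_beta beta_gt0 xi_ge2 => rb b0 xi2 t0t; have tt := t_gt0 t0t.
have pt : 0 < p t by rewrite /p; have := mulr_gt0 gamma_gt0 tt; lra.
have := is_derive_mul (is_derive1_powR (xi - 1) tt)
  (is_deriveV (lt0r_neq0 pt) (p_deriv t)).
move=> /is_derive_eq; apply.
have <- : t * t `^ (xi - 1 - 1) = t `^ (xi - 1).
  by rewrite mulr_powRB1 ?(ltW tt)//; lra.
have -> : r = p t - gamma * t by rewrite /p; ring.
rewrite -[_ *: gamma]/(- p t ^- 2 * gamma); field.
by rewrite !gt_eqF.
Qed.

Lemma energy_estimate t : t0 <= t ->
  t * p t * (F t + `|A (e t)|) <= 2 * C.
Proof.
move: r_ge_beta beta_gt0 xi_ge2 => rb b0 xi2 t0t.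
have p_gt0 s : t0 <= s -> 0 < p s.
  by rewrite /p => /t_gt0/(mulr_gt0 gamma_gt0); lra.
have tpF_ge0 s : t0 <= s -> 0 <= s * p s * F s.
  move=> t0s; rewrite !mulr_ge0 ?(ltW (t_gt0 t0s)) ?(ltW (p_gt0 _ t0s))//.
  by rewrite addr_ge0 ?phi_ge// mulr_ge0 ?sqr_ge0// divr_ge0// ltW.
have B_leC s : t0 <= s -> `|B s| <= C.
  by move=> t0s; have := B_le t0s; have := tpF_ge0 _ t0s; lra.
have I_le : `|I t| <= C.
  apply: (averaged_bound I_deriv weight_deriv) => // [s t0s|s t0s|||s t0s].
  (* The numerator equals [(xi - 2) gamma t + (xi - 1) r], nonnegative as [xi >= 2]. *)
  - apply: divr_ge0; last by apply: mulr_ge0; apply: ltW; [exact: t_gt0|exact: p_gt0].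
    have := mulr_ge0 (ltW gamma_gt0) (ltW (t_gt0 t0s)).
    have := p_gt0 _ t0s; rewrite /p; nra.
  - by apply: divr_gt0; [exact/powR_gt0/t_gt0|exact: p_gt0].
  - by rewrite /I /B !subrr scaler0 addr0 scaler0 addr0 subrr.
  - exact: le_trans (normr_ge0 _) (B_leC _ (lexx t0)).
  - by rewrite /I subrK B_leC.
(* As [z = B - I], its norm is at most [(C - t p F) + C], and [t p F] cancels. *)
have -> : t * p t * (F t + `|A (e t)|) = t * p t * F t + `|B t - I t|.
  rewrite /I subKr mulrDr normrZ ger0_norm//.
  by rewrite mulr_ge0 ?(ltW (t_gt0 t0t)) ?(ltW (p_gt0 _ t0t)).
have := ler_normB (B t) (I t); have := B_le t0t; lra.
Qed.

End energy_estimate.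

(** * Application to the solution of the system *)

Theorem theorem25 (R : realType) (X Y : hilbertType R)
    (f : X -> R) (A : {linear X -> Y}) (b : Y) (rho : R)
    (f_convex : convex_function (setT : set (convex_lmodType X)) f)
    (f_C2 : twice_continuously_differentiable f)
    (A_bounded : bounded_operator A)
    (rho_gt0 : 0 < rho)
    (xs : X) (ys : Y)
    (stationary : gradient f xs + adjoint A ys = 0)
    (feasible : A xs = b)
    (t0 alpha beta gamma r theta : R)
    (t0_gt0 : 0 < t0) (beta_gt0 : 0 < beta) (gamma_gt0 : 0 < gamma)
    (alpha_ge3 : 3 <= alpha) (r_ge_beta : beta <= r)
    (theta_ge : 1 / (alpha - 1) <= theta) (theta_le : theta <= 1 / 2)
    (x : R -> X) (y : R -> Y)
    (xy_solution : is_solution f A b rho t0 alpha beta gamma r theta x y)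
    (x0 dx0 : X) (y0 dy0 : Y)
    (init_x : x t0 = x0) (init_y : y t0 = y0)
    (init_dx : derive_on `[t0, +oo[%classic x t0 = dx0)
    (init_dy : derive_on `[t0, +oo[%classic y t0 = dy0) :
  let L := augmented_lagrangian f A b rho in
  let xi := 1 / theta in
  let eta := xi * (alpha - 1 - xi) in
  let W := energy f A b rho t0 beta gamma r xi eta xs ys x y in
  let C0 := 2 * W t0 + xi ^+ 2 + eta
            + t0 * (gamma * t0 + r) * `|A x0 - b| in
  forall t, t0 <= t ->
    0 <= L (x t) ys - L xs ys + `|A (x t) - b|
      <= 2 * C0 / (t * (gamma * t + r)) /\
    - (2 * C0 * `|ys|) / (t * (gamma * t + r)) <= f (x t) - f xs
      <= 2 * C0 * (1 + `|ys|) / (t * (gamma * t + r)).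
Proof.
(* With [b] replaced by [A xs], the residual becomes [A (x - xs)]. *)
subst b x0 y0 dx0 dy0 => L xi eta W C0 t t0t.
have [df ddf _] := f_C2.
have [xD yD ode] := xy_solution.
set D := `[t0, +oo[%classic in xD yD ode.
have inD s : t0 <= s -> D s by rewrite /D /= in_itv/= andbT.
(* [X0], [X1], [Y0], [Y1] prolong [x], [x'], [y], [y'] and agree with them from [t0] on. *)
have [X0 X0E dX0] := derivable_on_extension (fun s t0s => (xD s (inD s t0s)).1).
have [X1 X1E dX1] := derivable_on_extension (fun s t0s => (xD s (inD s t0s)).2).
have [Y0 Y0E dY0] := derivable_on_extension (fun s t0s => (yD s (inD s t0s)).1).
have [Y1 Y1E dY1] := derivable_on_extension (fun s t0s => (yD s (inD s t0s)).2).
have dfg u h : 'd f u h = '[gradient f u, h] by rewrite gradientP//.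
(* The base point is tied to the curve by an equation, so that this serves both the trajectory and a
   segment issued from [X0 s]. *)
have gH u s (c : R -> X) d : c s = u -> is_derive s 1 c d ->
    is_derive s 1 (fun s => gradient f (c s)) (hessian f u d).
  by move=> <- cd; exact: is_derive_comp_diff.
have ode_x s : t0 <= s ->
    derive_on D (derive_on D x) s + (alpha / s) *: X1 s
    + beta *: (hessian f (X0 s) (X1 s) + rho *: adjoint A (A (X1 s)))
    + (gamma + r / s) *: (gradient f (X0 s)
        + adjoint A (ys + (Y0 s - ys) + (theta * s) *: Y1 s)
        + rho *: adjoint A (A (X0 s - xs))) = 0.
  move=> t0s; have [+ _] := ode s t0s.
  rewrite hess_xx_lagrangianE// grad_x_lagrangianE//.
  by rewrite X1E// X0E// Y1E// Y0E// (addrC ys) subrK linearB.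
have ode_y s : t0 <= s ->
    derive_on D (derive_on D y) s + (alpha / s) *: Y1 s
    - (gamma + r / s) *: A (X0 s - xs + (theta * s) *: X1 s) = 0.
  move=> t0s; have [_] := ode s t0s.
  by rewrite grad_y_lagrangianE// X1E// X0E// Y1E// -linearB (addrAC (x s)).
have LE s : t0 <= s -> L (x s) ys - L xs ys =
    f (X0 s) - f xs + '[ys, A (X0 s - xs)] + rho / 2 * `|A (X0 s - xs)| ^+ 2.
  move=> t0s; rewrite /L !lagrangianE X0E// !hdot_norm (linearB A) subrr.
  by rewrite hdot0r normr0; ring.
have alpha1 : 0 < alpha - 1 by lra.
have theta0 : 0 < theta by apply: lt_le_trans theta_ge; exact: divr_gt0.
have xi_theta : xi * theta = 1 by rewrite /xi divfK// gt_eqF.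
have xi_ge2 : 2 <= xi by rewrite /xi ler_pdivlMr//; lra.
have xi_le : xi <= alpha - 1.
  by rewrite /xi ler_pdivrMr// mulrC -ler_pdivrMr.
have W0E : W t0 =
    2^-1 * (`|t0 *: X1 t0 + xi *: (X0 t0 - xs)| ^+ 2
            + `|t0 *: Y1 t0 + xi *: (Y0 t0 - ys)| ^+ 2)
    + eta / 2 * (`|X0 t0 - xs| ^+ 2 + `|Y0 t0 - ys| ^+ 2)
    + t0 * (gamma * t0 + r) * (f (X0 t0) - f xs + '[ys, A (X0 t0 - xs)]
        + rho / 2 * `|A (X0 t0 - xs)| ^+ 2)
    + beta * xi * t0
        * ('[gradient f (X0 t0), X0 t0 - xs] - (f (X0 t0) - f xs))
    + beta * xi * rho * t0 / 2 * `|A (X0 t0 - xs)| ^+ 2.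
  rewrite -(LE _ (lexx t0)) (X0E _ (lexx t0)) (X1E _ (lexx t0)).
  rewrite (Y0E _ (lexx t0)) (Y1E _ (lexx t0)) (linearB A).
  by rewrite /W /energy /prod_norm !sqr_sqrtr ?addr_ge0 ?sqr_ge0//=.
have C0E : C0 = 2 * W t0 + xi ^+ 2 + eta
    + t0 * (gamma * t0 + r) * `|A (X0 t0 - xs)|.
  by rewrite X0E// (linearB A).
(* This is the tangent inequality at [xs], where stationarity gives the slope [- adjoint A ys]. *)
have gap_ge0 s : t0 <= s -> 0 <= f (X0 s) - f xs + '[ys, A (X0 s - xs)].
  move=> t0s; have := convex_gradient_le f_convex df dfg xs (X0 s).
  have -> : gradient f xs = - adjoint A ys.
    by apply/eqP; rewrite -addr_eq0; apply/eqP.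
  rewrite hdotNl -(hdot_adjoint A_bounded) (hdotC ys).
  move: '[_, _] (f _) (f _) => d f1 f2; lra.
have estimate : t * (gamma * t + r) *
    (f (X0 t) - f xs + '[ys, A (X0 t - xs)] + rho / 2 * `|A (X0 t - xs)| ^+ 2
     + `|A (X0 t - xs)|) <= 2 * C0.
  rewrite C0E W0E.
  apply: (@energy_estimate R X Y A (adjoint A) A_bounded (hdot_adjoint A_bounded)
    t0 alpha beta gamma r theta xi rho t0_gt0 beta_gt0 gamma_gt0 r_ge_beta
    xi_theta xi_ge2 xi_le rho_gt0 (fun s => X0 s - xs) X1
    (derive_on D (derive_on D x)) (fun s => gradient f (X0 s))
    (fun s => hessian f (X0 s) (X1 s)) (fun s => Y0 s - ys) Y1
    (derive_on D (derive_on D y)) (fun s => f (X0 s) - f xs) ys) => // s t0s.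
  - by have := is_derive_sub (dX0 s t0s) (is_derive_const xs s); rewrite subr0 X1E.
  - by have := is_derive_sub (dY0 s t0s) (is_derive_const ys s); rewrite subr0 Y1E.
  - by apply: gH (erefl _) _; rewrite X1E//; exact: dX0.
  - have dX : is_derive s 1 X0 (X1 s) by rewrite X1E//; exact: dX0.
    have := is_derive_sub (is_derive_gradient (df (X0 s)) (dfg (X0 s)) dX)
      (is_derive_const (f xs) s).
    by rewrite subr0.
  - have := convex_gradient_le f_convex df dfg (X0 s) xs.
    rewrite -(opprB (X0 s)) hdotNr.
    move: '[_, _] (f _) (f _) => d f1 f2; lra.
  - apply: (convex_hessian_ge0 (u := X0 s) f_convex df dfg).
    apply: gH; last exact: is_derive_segment.
    by rewrite scale0r addr0.
rewrite (LE t t0t) -X0E// -(linearB A).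
have N0 := normr_ge0 (A (X0 t - xs)); have S0 := sqr_ge0 (`|A (X0 t - xs)|).
have gap0 := gap_ge0 t t0t.
have := cauchy_schwarz ys (A (X0 t - xs)); rewrite ler_norml => /andP[dot_ge dot_le'].
have Y0' := normr_ge0 ys.
have t_gt0 : 0 < t by exact: lt_le_trans t0t.
have P0 : 0 < t * (gamma * t + r).
  by rewrite mulr_gt0//; have := mulr_gt0 gamma_gt0 t_gt0; lra.
rewrite mulrC -ler_pdivlMr// in estimate.
rewrite mulNr !(mulrAC (2 * C0) _ _^-1).
move: estimate N0 S0 gap0 dot_ge dot_le' Y0'.
move: (2 * C0 / (t * (gamma * t + r))) `|A (X0 t - xs)| (f (X0 t) - f xs)
  '[ys, A (X0 t - xs)] `|ys| => K N F d M.
move=> estimate N0 S0 gap0 dot_ge dot_le' M0.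
have rN : 0 <= rho / 2 * N ^+ 2 by rewrite mulr_ge0// divr_ge0// ltW.
(* Here [F + d] and [rho / 2 * N ^+ 2] are nonnegative, so [N <= K] and [|d| <= M N <= M K]. Then
   [- d <= F <= K - d] gives the bounds on [F]. *)
have NK : N <= K by lra.
have MNK : M * N <= M * K by exact: ler_wpM2l.
clear -estimate N0 gap0 dot_ge dot_le' rN NK MNK.
split; apply/andP; split; lra.
Qed.
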